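(* Let $\mathbb{X}$ be an Asplund space, let $f:\mathbb{X}\rightarrow\mathbb{R}\cup\{+\infty\}$ be a proper lower semicontinuous function, let $\mathbf{S}_f:=\{x\in\mathbb{X}: f(x)\leq 0\}$ and let $\bar x\in\mathbf{S}_f$. Suppose that the inequality $f(x)\leq 0$ has a local error bound at $\bar x$ and that $f$ is continuous at $\bar x$. Then $$N(\mathbf{S}_f,\bar x)\subseteq [0,+\infty)\,\partial f(\bar x)+\partial^{\infty}f(\bar x).$$
   Context: A Banach space $\mathbb{X}$ is an Asplund space if every continuous convex real-valued function on a nonempty open convex set $D\subseteq\mathbb{X}$ is Fréchet differentiable at each point of some dense $G_\delta$ subset of $D$. $\mathbb{X}^*$ is the dual space, $\mathbb{B}(x,r)$ is the open ball with center $x$ and radius $r$, and $\mathbf{d}(x,\Omega):=\inf\{\|x-u\|:u\in\Omega\}$. Local error bound: the inequality $f(x)\leq 0$ has a local error bound at $\bar x\in\mathbf{S}_f$ if there exist $\tau,\delta\in(0,+\infty)$ such that $\mathbf{d}(x,\mathbf{S}_f)\leq\tau f_+(x)$ for all $x\in\mathbb{B}(\bar x,\delta)$, where $f_+(x):=\max\{f(x),0\}$. Normal cones: for a subset $A$ of a Banach space $\mathbb{X}$, $a\in A$ and $\varepsilon\geq 0$, let $\hat N_\varepsilon(A,a):=\{x^*\in\mathbb{X}^*:\limsup_{x\to a,\,x\in A}\frac{\langle x^*,x-a\rangle}{\|x-a\|}\leq\varepsilon\}$ and $\hat N(A,a):=\hat N_0(A,a)$ (Fréchet normal cone). The Mordukhovich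 (limiting) normal cone $N(A,a)$ is the set of $x^*\in\mathbb{X}^*$ for which there exist sequences $\varepsilon_n\downarrow 0$, $x_n\to a$ with $x_n\in A$, and $x_n^*\to x^*$ in the weak$^*$ topology with $x_n^*\in\hat N_{\varepsilon_n}(A,x_n)$ for all $n$ (in an Asplund space and for closed $A$ one may equivalently take $\varepsilon_n=0$). Subdifferentials: with $\mathrm{epi}\,f:=\{(x,r)\in\mathbb{X}\times\mathbb{R}: f(x)\leq r\}$ and $x$ with $f(x)<+\infty$, the Mordukhovich subdifferential is $\partial f(x):=\{x^*\in\mathbb{X}^*:(x^*,-1)\in N(\mathrm{epi}\,f,(x,f(x)))\}$ and the Mordukhovich singular subdifferential is $\partial^{\infty}f(x):=\{x^*\in\mathbb{X}^*:(x^*,0)\in N(\mathrm{epi}\,f,(x,f(x)))\}$.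
   Formalization: The set [0,+∞)∂f(x̄) is read with the convention 0·∅ = {0}, so it is {0} when ∂f(x̄) is empty; read literally as the empty set, the inclusion fails, e.g. for f(x) = -√|x| at 0. *)

(* Defs.v *)
From HB Require Import structures.
From mathcomp Require Import all_boot all_order all_algebra.
From mathcomp Require Import all_classical all_reals all_analysis.
From mathcomp Require Import borel_hierarchy.

Set Implicit Arguments.
Unset Strict Implicit.
Unset Printing Implicit Defensive.

Import Order.TTheory GRing.Theory Num.Theory.
Import numFieldNormedType.Exports.

Local Open Scope classical_set_scope.
Local Open Scope ring_scope.

(* A convex function on D is represented by a total function, of which only
   the values on D matter: D is open, so differentiability at a point of D is
   a property of the restriction to D, and a subset of D is a G_delta of the
   subspace D if and only if it is a G_delta of the whole space. *)
Definition asplund (R : realType) (X : completeNormedModType R) : Prop :=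
  forall (D : set X) (phi : X -> R^o),
    D !=set0 -> open D -> convex_set D ->
    convex_function D phi -> {within D, continuous phi} ->
    exists G : set X, [/\ Gdelta G, G `<=` D, D `<=` closure G &
      forall x, G x -> differentiable phi x].

Section NormalCones.
Context {R : realType} {E : normedModType R}.
Implicit Types (A : set E) (a : E) (eps : R).

(* The dual is a set of functions, so that its linear structure is that of
   E -> R^o and its weak* topology is that of pointwise convergence. *)
Definition topological_dual : set (E -> R^o) :=
  [set phi | linear phi /\ continuous phi].

Definition eps_normal eps A a : set (E -> R^o) :=
  [set phi | topological_dual phi /\
    (limf_esup (fun x => (phi (x - a) / `|x - a|)%:E) (within A a^')
       <= eps%:E)%E].

Definition limiting_normal A a : set (E -> R^o) :=
  [set phi | topological_dual phi /\
    exists (eps : nat -> R) (x : nat -> E) (phi_ : nat -> E -> R^o),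
      [/\ (forall n, 0 <= eps n) /\ nonincreasing_seq eps,
          eps @ \oo --> 0,
          (forall n, A (x n)) /\ x @ \oo --> a,
          (forall n, eps_normal (eps n) A (x n) (phi_ n)) &
          {ptws, phi_ @ \oo --> phi}]].

End NormalCones.

Section Subdifferentials.
Context {R : realType} {X : normedModType R}.
Implicit Types (f : X -> \bar R) (x : X).

Definition epigraph f : set (X * R^o) := [set p | (f p.1 <= p.2%:E)%E].

(* the functional (x^*, s) on X x R *)
Definition pair_dual (phi : X -> R^o) (s : R) : X * R^o -> R^o :=
  fun p => phi p.1 + s * p.2.

(* The two subdifferentials are only meaningful where f is finite. *)
Definition subdifferential f x : set (X -> R^o) :=
  [set phi | topological_dual phi /\
    limiting_normal (epigraph f) (x, fine (f x)) (pair_dual phi (-1))].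

Definition singular_subdifferential f x : set (X -> R^o) :=
  [set phi | topological_dual phi /\
    limiting_normal (epigraph f) (x, fine (f x)) (pair_dual phi 0)].

End Subdifferentials.

Section ErrorBounds.
Context {R : realType} {X : normedModType R}.
Implicit Types (f : X -> \bar R) (A : set X).

Definition dist_to A (x : X) : \bar R := ereal_inf [set `|x - u|%:E | u in A].

Definition solution_set f : set X := [set x | (f x <= 0)%E].

Definition local_error_bound f (xbar : X) : Prop :=
  exists tau delta : R, [/\ 0 < tau, 0 < delta &
    forall x, ball xbar delta x ->
      (dist_to (solution_set f) x <= tau%:E * maxe (f x) 0)%E].

Definition proper_function f : Prop :=
  (forall x, f x != -oo%E) /\ (exists x, (f x < +oo)%E).

End ErrorBounds.

(* [0, +oo) A, with the convention that 0 A = {0} also when A is empty. The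
   convention matters for a subdifferential, which may be empty: at 0, the
   function x |-> - sqrt `|x| on the real line is continuous and its Mordukhovich
   subdifferential is empty, while its solution set (the whole line) has normal
   cone {0}. For nonempty A, the first set is contained in the second one. *)
Definition nonneg_multiples (R : realType) (V : lmodType R) (A : set V)
    : set V :=
  [set 0] `|` [set t *: v | t in `[0, +oo[ & v in A].

Definition set_sum (V : zmodType) (A B : set V) : set V :=
  [set v + w | v in A & w in B].

(* Main.v *)
(** If [f xbar < 0], continuity makes [xbar] interior to [S_f], and the normal cone
    is [{0}].

    Suppose [f xbar = 0] and let [phi] be an [eps]-normal to [S_f] at a nearby [x0],
    with norm at most [M]. Moving from [x] to an almost nearest point of [S_f], the
    error bound gives, with [c = M tau],
      [phi (x - x0) <= c max(r, 0) + (3 eps + eta) |x - x0|]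
    for [(x, r)] in [epi f] near [(x0, 0)]. Replace [max(r, 0)] by the smooth
    majorant [(r + sqrt (r^2 + a^2)) / 2], which exceeds it by at most [a / 2].
    Then [(x0, 0)] almost minimizes the difference of the two sides over
    [epi f]. At a perturbed minimizer given by Ekeland's principle the smooth
    function has a slope [l] in [0, c], so [(phi, -l)] is there an
    [O(eps + eta)]-normal to [epi f].

    In the limit, norms stay bounded by the uniform boundedness principle and the
    slopes converge along a subsequence to some [l >= 0], so that [(phi, -l)] is a
    limiting normal to [epi f]: [phi] is in [l] times the subdifferential if
    [l > 0], and in the singular subdifferential if [l = 0]. *)
From HB Require Import structures.
Require Import Defs.
From mathcomp Require Import all_boot all_order all_algebra.
From mathcomp Require Import all_classical all_reals all_analysis.
From mathcomp Require Import ring lra.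

Set Implicit Arguments.
Unset Strict Implicit.
Unset Printing Implicit Defensive.

Import Order.TTheory GRing.Theory Num.Theory.
Import numFieldNormedType.Exports.
Local Open Scope classical_set_scope.
Local Open Scope ring_scope.

(** * Ekeland's variational principle, and the completeness of products needed to apply it on
    [X * R^o] *)

Lemma prod_cauchy_cvg (R : realType) (U V : completeNormedModType R)
    (F : set_system (U * V)) :
  ProperFilter F -> cauchy F -> exists z : (U * V)%type, F --> z.
Proof.
move=> FF /cauchy_ballP cF.
have /cauchy_cvgP/cvg_ex[x Fx] : cauchy (fst @ F).
  apply/cauchy_ballP => e e0; have [[A B] /= [FA FB] AB] := cF e e0.
  exists (fst @` A, fst @` B) => /=.
    by split; [apply: filterS FA|apply: filterS FB] => z Az; exists z.
  by move=> [_ _] /= [[a Aa <-] [b Bb <-]]; case: (AB (a, b) (conj Aa Bb)).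
have /cauchy_cvgP/cvg_ex[y Fy] : cauchy (snd @ F).
  apply/cauchy_ballP => e e0; have [[A B] /= [FA FB] AB] := cF e e0.
  exists (snd @` A, snd @` B) => /=.
    by split; [apply: filterS FA|apply: filterS FB] => z Az; exists z.
  by move=> [_ _] /= [[a Aa <-] [b Bb <-]]; case: (AB (a, b) (conj Aa Bb)).
exists (x, y).
move=> P /= /(cvg_pair Fx Fy); rewrite !nbhs_simpl /=.
by apply: filterS => -[].
Qed.

Section Ekeland.
Context {R : realType} {E : normedModType R}.
Hypothesis complete_E :
  forall F : set_system E, ProperFilter F -> cauchy F -> exists z : E, F --> z.
Variables (K : set E) (g : E -> R) (m eta : R).
Hypotheses (closedK : closed K) (cont_g : continuous g).
Hypotheses (g_ge : forall z, K z -> m <= g z) (eta0 : 0 < eta).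

(** Lower section of [z] in Ekeland's partial order: the points of [K] where [g] has dropped by at
    least [eta] times the distance travelled. *)
Let S z : set E := [set w | K w /\ g w + eta * `|w - z| <= g z].

Let S_trans z w u : S z w -> S w u -> S z u.
Proof.
move=> [Kw zw] [Ku wu]; split => //.
have : eta * `|u - z| <= eta * `|u - w| + eta * `|w - z|.
  by rewrite -mulrDr ler_pM2l// ler_distD.
lra.
Qed.

Let S_closed z : closed (S z).
Proof.
apply: closedI => //.
have ch : continuous (fun w => g w + eta * `|w - z|).
  move=> w; apply: cvgD; first exact: cont_g.
  apply: cvgM; first exact: cvg_cst.
  by apply: cvg_norm; apply: cvgB; [exact: cvg_id|exact: cvg_cst].
exact: (preimage_closed (fun w _ => ch w) (@closed_le _ (g z))).
Qed.

(** Take [w] in [S z] with [g w] within [eta * e] of the infimum of [g] over [S z]. Points of [S w]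
    remain in [S z], so from [w] the value can drop by less than [eta * e]. *)
Let S_small z e : K z -> 0 < e ->
  exists w, S z w /\ forall u, S w u -> `|u - w| < e.
Proof.
move=> Kz e0.
have hi : has_inf (g @` S z).
  split; first by exists (g z), z => //; split; rewrite ?subrr ?normr0 ?mulr0 ?addr0.
  by exists m => _ [w [Kw _] <-]; exact: g_ge.
have [_ [w Szw <-] gw] := inf_adherent (mulr_gt0 eta0 e0) hi.
exists w; split => // u Swu.
have : inf (g @` S z) <= g u.
  by apply: ge_inf; [case: hi|exists u => //; exact: S_trans Swu].
case: Swu => _; rewrite -(ltr_pM2l eta0); lra.
Qed.

Lemma ekeland z0 : K z0 -> exists z, [/\ K z, g z + eta * `|z - z0| <= g z0 &
  forall w, K w -> g z <= g w + eta * `|w - z|].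
Proof.
move=> Kz0.
(* The index is carried along with the point, so that the radius required of the next section
   shrinks with each iteration. *)
have /choice[next nextP] (p : nat * E) : exists w, K p.2 ->
    S p.2 w /\ forall u, S w u -> `|u - w| < p.1.+1%:R^-1.
  have [Kp|nKp] := pselect (K p.2); last by exists p.2.
  have n0 : (0 : R) < p.1.+1%:R^-1 by rewrite invr_gt0.
  by have [w] := S_small Kp n0; exists w.
pose z := fix z n := if n is k.+1 then next (k, z k) else z0.
have Kz n : K (z n) by elim: n => //= n Kzn; have [[]] := nextP (n, z n) Kzn.
have Sz n k : S (z n) (z (k + n)%N).
  elim: k => [|k ih]; first by split; rewrite ?subrr ?normr0 ?mulr0 ?addr0.
  apply: S_trans ih _; rewrite addSn /=.
  by have [] := nextP (k + n, z (k + n))%N (Kz (k + n)%N).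
have zS n u : S (z n.+1) u -> `|u - z n.+1| < n.+1%:R^-1.
  by have [_ /(_ u)] := nextP (n, z n) (Kz n).
have small (e : R) : 0 < e -> exists n : nat, n.+1%:R^-1 < e.
  move=> e0; have /cvgr0_norm_lt/(_ _ e0)[N _ /(_ N (leqnn N))] := @cvg_harmonic R.
  by rewrite /= ger0_norm ?invr_ge0//; exists N.
have [l zl] : exists l : E, z @ \oo --> l.
  apply: complete_E; apply: cauchy_exP => e e0; have [n ne] := small e e0.
  exists (z n.+1); exists n.+1 => // k /= nk.
  rewrite -ball_normE /= distrC (lt_trans _ ne)// zS//.
  by have := Sz n.+1 (k - n.+1)%N; rewrite subnK.
have Sl n : S (z n) l.
  apply: closed_cvg zl; first exact: S_closed.
  by exists n => // k /= nk; have := Sz n (k - n)%N; rewrite subnK.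
have [Kl gl] := Sl 0%N.
(* A violator [w] lies in [S l], hence in every [S (z n.+1)]. These sections shrink to [l], so
   [w = l], where the strict inequality [wl] is absurd. *)
exists l; split=> // w Kw; rewrite leNgt; apply/negP => wl.
have Slw : S l w by split => //; exact: ltW.
suff wE : w = l by move: wl; rewrite wE subrr normr0 mulr0 addr0 ltxx.
apply/eqP; rewrite -subr_eq0 -normr_eq0 eq_le normr_ge0 andbT.
apply/ler_addgt0Pr => e e0; rewrite add0r.
have [n ne] := small (e / 2) (divr_gt0 e0 (ltr0Sn R 1)).
have h1 := zS n _ (Sl n.+1).
have h2 := zS n _ (S_trans (Sl n.+1) Slw).
rewrite (le_trans (ler_distD (z n.+1) w l))// (splitr e) (distrC _ l) lerD//.
  exact: ltW (lt_trans h2 ne).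
exact: ltW (lt_trans h1 ne).
Qed.

End Ekeland.

(** * Continuous linear functionals and elementary properties of normals *)

Section TopologicalDual.
Context {R : realType} {E : normedModType R}.
Implicit Types (A : set E) (a : E) (phi : E -> R^o).

(** Bundles a function with its linearity proof, so that results on linear maps apply to members of
    the dual. *)
Definition linear_of_dual phi (lphi : linear phi) : {linear E -> R^o} :=
  HB.pack phi (GRing.isLinear.Build _ _ _ _ phi lphi).

Lemma dual0 phi : topological_dual phi -> phi 0 = 0.
Proof. by move=> [lphi _]; exact: (linear0 (linear_of_dual lphi)). Qed.

Lemma dualB phi : topological_dual phi -> {morph phi : x y / x - y}.
Proof. by move=> [lphi _]; exact: (linearB (linear_of_dual lphi)). Qed.

Lemma dualZ phi t : topological_dual phi -> {morph phi : x / t *: x >-> t * x}.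
Proof. by move=> [lphi _] x; exact: (linearZ_LR (linear_of_dual lphi)). Qed.

Lemma dual_scale phi t : topological_dual phi -> topological_dual (t *: phi).
Proof.
move=> [lphi cphi]; split.
  by move=> k x y; rewrite /= !fctE lphi scalerDr !scalerA (mulrC t).
by move=> x; apply: cvgZl_tmp; exact: cphi.
Qed.

Lemma dual_bounded_fun_norm phi : topological_dual phi -> bounded_fun_norm phi.
Proof.
move=> [lphi cphi] r.
have /linear_boundedP : bounded_near (linear_of_dual lphi) (nbhs (0 : E)).
  exact/linear_bounded_continuous.
(* [MP] needs a constant strictly above [M]; nonnegativity of [N] gives [N * |x| <= N * r]. *)
move=> [M [Mreal MP]]; pose N := Num.max (M + 1) 0.
exists (N * r) => x xr.
have /MP/(_ x) : M < N by rewrite /N lt_max; apply/orP; left; lra.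
move=> /le_trans; apply; apply: ler_wpM2l => //.
by rewrite /N le_max lexx orbT.
Qed.

(** The strict slack [eps < e] absorbs the gap between an upper limit and a bound on a
    neighbourhood. Clearing the denominator admits [x = a], where both sides vanish. *)
Lemma eps_normalP eps A a phi : eps_normal eps A a phi <->
  topological_dual phi /\ forall e, eps < e ->
    \forall x \near a, A x -> phi (x - a) <= e * `|x - a|.
Proof.
split=> -[dphi h]; split=> //.
  move=> e ee; have : (limf_esup (fun x => (phi (x - a) / `|x - a|)%:E)
      (within A a^') < e%:E)%E by rewrite (le_lt_trans h)// lte_fin.
  move=> /ereal_inf_lt[_ [V aV <-] Ve].
  have : \forall x \near a, x != a -> A x -> V x by exact: aV.
  apply: filterS => x xV Ax; have [->|xa] := eqVneq x a.
    by rewrite subrr (dual0 dphi) normr0 mulr0.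
  rewrite -ler_pdivrMr ?normr_gt0 ?subr_eq0// -lee_fin (le_trans _ (ltW Ve))//.
  by apply: ereal_sup_ubound; exists x => //; exact: xV.
apply/lee_addgt0Pr => e e0; rewrite -EFinD.
have {}h : \forall x \near a, A x -> phi (x - a) <= (eps + e) * `|x - a|.
  by apply: h; rewrite ltrDl.
(* The upper limit is an infimum of suprema over sets of the filter; the set where the quotient is
   at most [eps + e] is one of them. *)
apply: (@le_trans _ _ (ereal_sup [set (phi (x - a) / `|x - a|)%:E | x in
    [set x | phi (x - a) / `|x - a| <= eps + e]])).
  apply: ereal_inf_lbound; eexists; last reflexivity.
  apply: filterS h => x h xa Ax /=.
  by rewrite ler_pdivrMr ?normr_gt0 ?subr_eq0//; exact: h.
by apply: ge_ereal_sup => _ [x /= xe <-]; rewrite lee_fin.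
Qed.

Lemma eps_normalZ eps A a phi t : 0 < t ->
  eps_normal eps A a phi -> eps_normal (t * eps) A a (t *: phi).
Proof.
move=> t0 /eps_normalP[dphi h]; apply/eps_normalP; split; first exact: dual_scale.
move=> e ee; have /h : eps < e / t by rewrite ltr_pdivlMr// mulrC.
apply: filterS => x /[apply]; rewrite fctE.
by rewrite -(ler_pM2l t0) mulrA (mulrC t (e / t)) divfK// gt_eqF.
Qed.

Lemma limiting_normalZ A a phi t : 0 < t ->
  limiting_normal A a phi -> limiting_normal A a (t *: phi).
Proof.
move=> t0 [dphi [eps [x [psi [[eps0 deps] eps_cvg x_cvg npsi psi_cvg]]]]].
split; first exact: dual_scale.
exists (fun n => t * eps n), x, (fun n => t *: psi n); split => //.
- split=> [n|n k nk]; first by rewrite mulr_ge0// ltW.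
  by rewrite ler_pM2l// deps.
- by rewrite -(mulr0 t); apply: cvgM => //; exact: cvg_cst.
- by move=> n; exact: eps_normalZ.
- apply/pointwise_cvgP => v; apply: cvgZl_tmp.
  by move/pointwise_cvgP : psi_cvg; apply.
Qed.

Lemma limiting_normal0 A a : A a -> limiting_normal A a (0 : E -> R^o).
Proof.
have d0 : topological_dual (0 : E -> R^o).
  by split=> [k x y|x]; [rewrite /= scaler0 addr0|exact: cvg_cst].
move=> Aa; split=> //; exists (fun=> 0), (fun=> a), (fun=> 0); split.
- by split.
- exact: cvg_cst.
- by split=> //; exact: cvg_cst.
- move=> _; apply/eps_normalP; split => // e e0.
  by apply: nearW => x _; rewrite mulr_ge0// ltW.
- by apply/pointwise_cvgP => v; exact: cvg_cst.
Qed.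

(** For small [t > 0] the point [a + t *: v] stays in [A], and homogeneity cancels [t]. *)
Lemma eps_normal_interior eps A a phi v :
  nbhs a A -> eps_normal eps A a phi -> phi v <= eps * `|v|.
Proof.
move=> aA /eps_normalP[dphi h]; apply/ler_addgt0Pr => e e0.
have [->|v0] := eqVneq v 0; first by rewrite (dual0 dphi) normr0 mulr0 add0r ltW.
pose e' := eps + e / `|v|.
have ee' : eps < e' by rewrite ltrDl divr_gt0// normr_gt0.
have -> : eps * `|v| + e = e' * `|v| by rewrite mulrDl divfK// normr_eq0.
have : a + t *: v @[t --> (0 : R)^'+] --> a.
  rewrite -[X in _ --> X]addr0 -(scale0r v).
  apply: cvgD; first exact: cvg_cst.
  by apply: cvgZr_tmp; apply: cvg_at_right_filter; exact: cvg_id.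
move=> /(_ _ (filterI aA (h _ ee')))/= near_t.
near (0 : R)^'+ => t.
have t0 : 0 < t by near: t; exact: nbhs_right_gt.
have [/[swap]/[apply]] : A (a + t *: v) /\
    (A (a + t *: v) -> phi (a + t *: v - a) <= e' * `|a + t *: v - a|).
  by near: t; exact: near_t.
rewrite addrAC subrr add0r (dualZ _ dphi) normrZ (gtr0_norm t0).
by rewrite mulrCA ler_pM2l.
Unshelve. all: by end_near. Qed.

(** The base points are eventually interior to [A], so [psi n v <= eps n * |v|]. In the limit
    [phi v <= 0], and likewise at [- v]. *)
Lemma limiting_normal_interior A a phi :
  nbhs a A -> limiting_normal A a phi -> phi = 0.
Proof.
move=> aA [dphi [eps [x [psi [_ eps_cvg [_ x_cvg] npsi /pointwise_cvgP psi_cvg]]]]].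
have phi_le0 v : phi v <= 0.
  have eps_v : eps n * `|v| @[n --> \oo] --> (0 : R).
    by rewrite -(mul0r `|v|); apply: cvgM => //; exact: cvg_cst.
  have psi_v : psi n v @[n --> \oo] --> phi v := psi_cvg v.
  apply: (ler_cvg_to psi_v eps_v).
  have xA : \forall n \near \oo, nbhs (x n) A := x_cvg _ (nbhs_interior aA).
  by apply: filterS xA => n An; exact: eps_normal_interior (npsi n).
apply/funext => v; apply/eqP; rewrite eq_le phi_le0 /=.
by have := phi_le0 (0 - v); rewrite (dualB dphi) (dual0 dphi) sub0r oppr_le0.
Qed.

End TopologicalDual.

(** * Functionals on the product and closedness of the epigraph *)

Section PairDual.
Context {R : realType} {X : normedModType R}.

Lemma pair_dual_topological (phi : X -> R^o) s :
  topological_dual phi -> topological_dual (pair_dual phi s).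
Proof.
move=> [lphi cphi]; split.
  move=> k [x r] [y t]; rewrite /pair_dual /= lphi /=.
  rewrite /GRing.scale /=; ring.
move=> [x r]; apply: cvgD.
  by apply: (cvg_comp _ _ cvg_fst); exact: cphi.
by apply: cvgM; [exact: cvg_cst|exact: cvg_snd].
Qed.

Lemma closed_epigraph (f : X -> \bar R) :
  lower_semicontinuous f -> closed (epigraph f).
Proof.
move=> lscf; rewrite -openC openE => -[x r] /= /negP; rewrite -ltNge => rf.
have [s rs sf] : exists2 s, r < s & (s%:E < f x)%E.
  case: (f x) rf => [t|_|//]; last by exists (r + 1); [rewrite ltrDl|rewrite ltry].
  by rewrite lte_fin => rt; exists ((r + t) / 2); rewrite ?lte_fin !midf_lt.
have [V Vx fV] := lscf _ _ sf.
exists (V, [set t | t < s]); first by split => //=; exact: open_nbhs_nbhs.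
move=> [y t] /= [Vy ts]; apply/negP; rewrite -ltNge.
by rewrite (lt_trans _ (fV _ Vy))// lte_fin.
Qed.

End PairDual.

(** * Smoothing of the positive part *)

Section SmoothMax.
Context {R : realType}.
Implicit Types a r : R.

Definition smooth_max a r := (r + Num.sqrt (r ^+ 2 + a ^+ 2)) / 2.

Lemma smooth_max_ge a r : Num.max r 0 <= smooth_max a r.
Proof.
have h : `|r| <= Num.sqrt (r ^+ 2 + a ^+ 2).
  by rewrite -sqrtr_sqr ler_sqrt// ?addr_ge0 ?sqr_ge0// lerDl sqr_ge0.
rewrite /smooth_max ge_max; have := ler_norm r; have := ler_norm (- r).
rewrite normrN; move: h; set s := Num.sqrt _; move=> *; apply/andP; split; lra.
Qed.

Lemma smooth_max0 a : 0 <= a -> smooth_max a 0 = a / 2.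
Proof. by move=> a0; rewrite /smooth_max expr0n /= !add0r sqrtr_sqr ger0_norm. Qed.

Lemma continuous_smooth_max a : continuous (smooth_max a : R^o -> R^o).
Proof.
move=> r; apply: cvgM; last exact: cvg_cst.
apply: cvgD; first exact: cvg_id.
apply: (@continuous_comp R R R (fun t => t ^+ 2 + a ^+ 2)); last exact: sqrt_continuous.
by apply: (@cvgD _ R); [exact: exprn_continuous|exact: cvg_cst].
Qed.

(** The slope is the derivative at [r], which is [(1 + r / s) / 2] with [|r| <= s]. The second-order
    remainder is controlled uniformly in [r] because [s >= a]. *)
Lemma smooth_max_tangent a r : 0 < a -> exists2 l : R, 0 <= l <= 1 &
  forall t, smooth_max a t <= smooth_max a r + l * (t - r) + (t - r) ^+ 2 / a.
Proof.
move=> a0; set s := Num.sqrt (r ^+ 2 + a ^+ 2).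
have as_ : a <= s.
  rewrite -[leLHS]ger0_norm ?(ltW a0)// -sqrtr_sqr ler_sqrt ?addr_ge0 ?sqr_ge0//.
  by rewrite lerDr sqr_ge0.
have rs : `|r| <= s.
  by rewrite -sqrtr_sqr ler_sqrt ?addr_ge0 ?sqr_ge0// lerDl sqr_ge0.
have s0 : 0 < s by exact: lt_le_trans as_.
have s2 : s ^+ 2 = r ^+ 2 + a ^+ 2 by rewrite sqr_sqrtr// addr_ge0 ?sqr_ge0.
exists ((1 + r / s) / 2).
  have : `|r / s| <= 1.
    by rewrite normrM normfV (gtr0_norm s0) ler_pdivrMr// mul1r.
  by rewrite ler_norml; lra.
move=> t; rewrite /smooth_max -/s; set S := Num.sqrt (t ^+ 2 + a ^+ 2).
have S2 : S ^+ 2 = t ^+ 2 + a ^+ 2 by rewrite sqr_sqrtr// addr_ge0 ?sqr_ge0.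
(* AM-GM: [2 S s <= S^2 + s^2] *)
have h : S <= s + r / s * (t - r) + (t - r) ^+ 2 / s / 2.
  have -> : s + r / s * (t - r) + (t - r) ^+ 2 / s / 2 = (S ^+ 2 + s ^+ 2) / (2 * s).
    by rewrite S2 [X in _ = (_ + X) / _]s2; field : s2; rewrite gt_eqF.
  rewrite ler_pdivlMr ?mulr_gt0//; have := sqr_ge0 (S - s); nra.
have : (t - r) ^+ 2 / s <= (t - r) ^+ 2 / a by rewrite ler_wpM2l ?sqr_ge0// lef_pV2.
have : 0 <= (t - r) ^+ 2 / s by rewrite divr_ge0 ?sqr_ge0// ltW.
lra.
Qed.

End SmoothMax.

(** * From normals to the solution set to normals to the epigraph *)

Lemma solution_normal_ineq (R : realType) (X : normedModType R)
    (f : X -> \bar R) (tau M e : R) (x0 : X) (phi : X -> R^o) (eta : R) :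
  0 < tau -> 0 <= M -> 0 <= e ->
  (\forall x \near x0, (dist_to (solution_set f) x <= tau%:E * maxe (f x) 0)%E) ->
  (forall x, `|phi x| <= M * `|x|) -> solution_set f x0 ->
  eps_normal e (solution_set f) x0 phi -> 0 < eta ->
  \forall x \near x0, forall r : R, (f x <= r%:E)%E ->
    phi (x - x0) <= M * tau * Num.max r 0 + (3 * e + eta) * `|x - x0|.
Proof.
move=> tau0 M0 e0 bound phiM Sx0 nphi eta0.
have [dphi lphi] := (eps_normalP _ _ _ _).1 nphi.
(* The point [u] below is within [3 * |x - x0|] of [x0], and [3 * e' = 3 * e + eta / 2]; the other
   half of [eta] pays for [M * q]. *)
pose e' := e + eta / 6.
have ee' : e < e' by rewrite /e'; lra.
have /nbhs_normP[rho /= rho0 nrho] := lphi _ ee'.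
pose q : R := eta / (eta + 2 * (M + 1)).
have den0 : 0 < eta + 2 * (M + 1) :> R by lra.
have q0 : 0 < q by rewrite divr_gt0.
have q1 : q <= 1 by rewrite ler_pdivrMr//; lra.
have Mq : M * q <= eta / 2.
  by rewrite mulrA ler_pdivrMr; nra.
have near_x0 : \forall x \near x0, `|x - x0| < rho / 3.
  apply/nbhs_normP; exists (rho / 3) => /=; first by rewrite divr_gt0.
  by move=> x /=; rewrite distrC.
near=> x => r fxr.
have rho3 : `|x - x0| < rho / 3 by near: x.
have bound_x : (dist_to (solution_set f) x <= tau%:E * maxe (f x) 0)%E by near: x.
(* The slack [t * q] used below has to be positive, so [x = x0] is treated apart. *)
have [xx0|xx0] := eqVneq x x0.
  rewrite xx0 subrr (dual0 dphi) normr0 mulr0 addr0 !mulr_ge0 ?(ltW tau0)//.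
  by rewrite le_max lexx orbT.
set t := `|x - x0| in rho3 *; set r' := Num.max r 0.
have t0 : 0 < t by rewrite normr_gt0 subr_eq0.
have r'0 : 0 <= r' by rewrite le_max lexx orbT.
have dt : (dist_to (solution_set f) x <= t%:E)%E.
  by apply: ereal_inf_lbound; exists x0.
have dr : (dist_to (solution_set f) x <= (tau * r')%:E)%E.
  rewrite (le_trans bound_x)//.
  rewrite EFinM lee_wpmul2l ?lee_fin ?(ltW tau0)// EFin_max ge_max.
  by rewrite !le_max fxr lexx orbT.
(* The slack [t * q] replaces attainment of the infimum. Since [x0] is a solution, the distance is
   also at most [t]; with [q <= 1] this keeps [u] within [3 * t < rho] of [x0]. *)
have [u [Su xut xur]] : exists u, [/\ solution_set f u,
    `|x - u| < t + t * q & `|x - u| < tau * r' + t * q].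
  have : (dist_to (solution_set f) x < (Num.min t (tau * r') + t * q)%:E)%E.
    have /le_lt_trans -> // : (dist_to (solution_set f) x <= (Num.min t (tau * r'))%:E)%E.
      by case: (leP t (tau * r')).
    by rewrite lte_fin ltrDl mulr_gt0.
  move=> /ereal_inf_lt[_ [u Su <-]]; rewrite lte_fin addr_minl lt_min => /andP[? ?].
  by exists u.
have ux0 : `|u - x0| <= 3 * t.
  have := ler_distD x u x0; rewrite (distrC u x) -/t; nra.
have h1 : phi (u - x0) <= e' * (3 * t).
  have /nrho : `|x0 - u| < rho by rewrite distrC; lra.
  move=> /(_ Su)/le_trans; apply; rewrite ler_wpM2l// /e'; lra.
have h2 : phi (x - u) <= M * (tau * r' + t * q).
  rewrite (le_trans (ler_norm _))// (le_trans (phiM _))//.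
  by rewrite ler_wpM2l// ltW.
have -> : phi (x - x0) = phi (x - u) + phi (u - x0).
  by rewrite !(dualB dphi) addrA subrK.
have : M * q * t <= eta / 2 * t by rewrite ler_wpM2r// ltW.
rewrite (le_trans (lerD h2 h1))// /e'; nra.
Unshelve. all: by end_near. Qed.

Lemma normr_fst (R : realType) (U V : normedModType R) (z : U * V) :
  `|z.1| <= `|z|.
Proof. by rewrite prod_normE le_max lexx. Qed.

Lemma normr_snd (R : realType) (U V : normedModType R) (z : U * V) :
  `|z.2| <= `|z|.
Proof. by rewrite prod_normE le_max lexx orbT. Qed.

Lemma epigraph_normal_of_solution_normal (R : realType)
    (X : completeNormedModType R) (f : X -> \bar R) (tau M e : R) (x0 : X)
    (phi : X -> R^o) (eta : R) :
  lower_semicontinuous f -> 0 < tau -> 0 <= M -> 0 <= e ->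
  (\forall x \near x0, (dist_to (solution_set f) x <= tau%:E * maxe (f x) 0)%E) ->
  (forall x, `|phi x| <= M * `|x|) -> solution_set f x0 ->
  eps_normal e (solution_set f) x0 phi -> 0 < eta ->
  exists (z : X * R^o) (l : R), [/\ epigraph f z, `|z - (x0, 0)| <= eta,
    0 <= l <= M * tau & eps_normal (3 * e + eta) (epigraph f) z (pair_dual phi (- l))].
Proof.
move=> lscf tau0 M0 e0 bound phiM Sx0 nphi eta0.
have [dphi _] := nphi.
pose eta' := eta / 4; have eta'0 : 0 < eta' by rewrite divr_gt0.
have /nbhs_normP[rho /= rho0 nrho] :=
  solution_normal_ineq tau0 M0 e0 bound phiM Sx0 nphi eta'0.
pose c := M * tau; have c0 : 0 <= c by rewrite mulr_ge0// ltW.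
(* The radius stays below [rho], so that [nrho] makes [g] nonnegative on this closed set. *)
pose K := epigraph f `&` [set z : X * R^o | `|z.1 - x0| <= rho / 2].
(* Then [g (x0, 0) = c * (a / 2)] is so small that Ekeland's point moves by at most
   [Num.min (rho / 4) eta]. The denominator is [c + 1] because [c] may be 0. *)
pose a := eta' * Num.min (rho / 4) eta / (c + 1).
have min0 : 0 < Num.min (rho / 4) eta by rewrite lt_min eta0 divr_gt0.
have a0 : 0 < a by rewrite divr_gt0 ?mulr_gt0// ltr_wpDl.
pose g (z : X * R^o) : R :=
  c * smooth_max a z.2 - phi (z.1 - x0) + (3 * e + eta') * `|z.1 - x0|.
have closedK : closed K.
  apply: closedI; first exact: closed_epigraph.
  have ch : continuous (fun z : X * R^o => `|z.1 - x0|).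
    by move=> z; apply: cvg_norm; apply: cvgB; [exact: cvg_fst|exact: cvg_cst].
  exact: (preimage_closed (fun w _ => ch w) (@closed_le _ (rho / 2))).
have cont_g : continuous g.
  have cfst : continuous (fun z : X * R^o => z.1 - x0).
    by move=> z; apply: cvgB; [exact: cvg_fst|exact: cvg_cst].
  have csnd : continuous (fun z : X * R^o => smooth_max a z.2).
    move=> z; apply: (@continuous_comp _ R R snd (smooth_max a)).
      exact: cvg_snd.
    exact: continuous_smooth_max.
  have cphi : continuous (fun z : X * R^o => phi (z.1 - x0)).
    move=> z; apply: (@continuous_comp _ X R (fun z : X * R^o => z.1 - x0)).
      exact: cfst.
    exact: dphi.2.
  move=> z; apply: (@cvgD R R); first apply: (@cvgB R R).
  - by apply: (@cvgM R); [exact: cvg_cst|exact: csnd].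
  - exact: cphi.
  - by apply: (@cvgM R); [exact: cvg_cst|exact: (cvg_norm (cfst z))].
have g_ge0 z : K z -> 0 <= g z.
  move=> [fz zx0].
  have /nrho/(_ _ fz) : `|x0 - z.1| < rho by rewrite distrC; move: zx0 => /=; lra.
  have := ler_wpM2l c0 (smooth_max_ge a z.2).
  rewrite -/c /g; lra.
have Kz0 : K (x0, 0) by split => //=; rewrite subrr normr0 divr_ge0// ltW.
have gz0 : g (x0, 0) = c * (a / 2).
  by rewrite /g /= subrr (dual0 dphi) normr0 (smooth_max0 (ltW a0)) subr0 mulr0 addr0.
have [z [[fz zx0] zz0 zmin]] :=
  ekeland (@prod_cauchy_cvg R X R^o) closedK cont_g g_ge0 eta'0 Kz0.
have ca : c * a <= eta' * Num.min (rho / 4) eta.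
  by rewrite /a mulrCA ler_piMr// ?mulr_ge0 ?ltW// ltr_pdivrMr; lra.
have {zz0} : `|z - (x0, 0)| <= Num.min (rho / 4) eta.
  rewrite -(ler_pM2l eta'0); have := g_ge0 _ (conj fz zx0).
  have : 0 <= c * a by rewrite mulr_ge0// ltW.
  move: zz0; rewrite gz0; lra.
rewrite le_min => /andP[z_rho z_eta].
have [l /andP[l0 l1] ltan] := smooth_max_tangent (z.2 : R) a0.
exists z, (c * l); split => //.
  by rewrite mulr_ge0//= ler_piMr.
apply/eps_normalP; split; first exact: pair_dual_topological.
move=> e1 ee1.
(* The first bound keeps [w] in the strip defining [K], since [z] is within [rho / 4] of [(x0, 0)].
   The second makes the quadratic remainder [c * (d ^+ 2 / a)] at most [eta' * D]. *)
pose s : R := Num.min (rho / 4) (eta' * a / (c + 1)).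
have c1 : 0 < c + 1 by rewrite ltr_wpDl.
have s0 : 0 < s by rewrite /s lt_min; apply/andP; split; rewrite divr_gt0// mulr_gt0.
have near_z : \forall w \near z, `|w - z| < s.
  by apply/nbhs_normP; exists s => //= w /=; rewrite distrC.
apply: filterS near_z => w; rewrite lt_min => /andP[wz_rho wz_a] fw.
set D := `|w - z| in wz_rho wz_a *.
have D0 : 0 <= D by exact: normr_ge0.
have fst_le : `|w.1 - z.1| <= D by exact: normr_fst (w - z).
have snd_le : `|w.2 - z.2| <= D by exact: normr_snd (w - z).
have Kw : K w.
  split=> //=; have := ler_distD z.1 w.1 x0.
  have := normr_fst (z - (x0, 0)); rewrite /=; lra.
have cD : c * D <= eta' * a.
  by move: wz_a; rewrite ltr_pdivlMr//; nra.
pose d : R := w.2 - z.2.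
have cd : c * (d ^+ 2 / a) <= eta' * D.
  rewrite mulrA ler_pdivrMr// -(real_normK (num_real d)).
  rewrite (@le_trans _ _ (c * D * D))//; last by rewrite [leRHS]mulrAC ler_wpM2r.
  by rewrite -mulrA -expr2 ler_wpM2l// lerXn2r// nnegrE.
have tan := ler_wpM2l c0 (ltan w.2); rewrite -/d in tan.
have dist : `|w.1 - x0| <= D + `|z.1 - x0|.
  by rewrite (le_trans (ler_distD z.1 _ _))// lerD2r.
have {}dist : (3 * e + eta') * `|w.1 - x0| <= (3 * e + eta') * (D + `|z.1 - x0|).
  by rewrite ler_wpM2l//; lra.
have e1D : (3 * e + eta) * D <= e1 * D by rewrite ler_wpM2r// ltW.
have etaD : 0 <= eta * D by rewrite mulr_ge0// ltW.
have gzw : g z <= g w + eta' * D := zmin _ Kw.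
have -> : pair_dual phi (- (c * l)) (w - z) =
    phi (w.1 - x0) - phi (z.1 - x0) - c * l * d :> R.
  by rewrite /pair_dual -(dualB dphi) opprB addrA subrK mulNr.
(* Three errors [eta' * D] add up, from the quadratic remainder, the norm term of [g] and Ekeland's
   inequality; [eta'] is a quarter of [eta]. *)
have sum_up (sz sw pz pw nz nw q : R) : c * q <= eta' * D ->
    c * sw <= c * (sz + l * d + q) ->
    (3 * e + eta') * nw <= (3 * e + eta') * (D + nz) ->
    c * sz - pz + (3 * e + eta') * nz <= c * sw - pw + (3 * e + eta') * nw + eta' * D ->
    pw - pz - c * l * d <= e1 * D.
  move: e1D; rewrite /eta'; lra.
exact: sum_up cd tan dist gzw.
Qed.

(** * Uniform boundedness and passage to the limit *)

Lemma ptws_cvg_bounded (R : realType) (X : completeNormedModType R)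
    (phi_ : nat -> X -> R^o) (phi : X -> R^o) :
  (forall n, topological_dual (phi_ n)) -> {ptws, phi_ @ \oo --> phi} ->
  exists2 M : R, 0 <= M & forall n x, `|phi_ n x| <= M * `|x|.
Proof.
move=> dphi /pointwise_cvgP phi_cvg.
have [||M MP] := @Banach_Steinhauss R X R^o (range phi_) _ _ 1.
- by move=> _ [n _ <-]; split; [exact: dual_bounded_fun_norm|exact: (dphi n).1].
- move=> x; have phi_x : phi_ n x @[n --> \oo] --> phi x := phi_cvg x.
  have /cvg_seq_bounded[B [_ BP]] : cvgn (fun n => phi_ n x) by apply/cvg_ex; exists (phi x).
  exists (B + 1) => _ [n _ <-]; by apply: (BP (B + 1)); rewrite ?ltrDl.
exists (Num.max M 0); first by rewrite le_max lexx orbT.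
move=> n x; have [->|x0] := eqVneq x 0.
  by rewrite (dual0 (dphi n)) !normr0 mulr0.
have nx0 : 0 < `|x| by rewrite normr_gt0.
(* [MP] bounds the functionals on the unit ball only; the general bound follows by normalizing
   [x]. *)
have /(_ (`|x|^-1 *: x)) := MP (phi_ n) (ex_intro2 _ _ n I erefl).
rewrite normrZ normfV normr_id mulVf ?gt_eqF// => /(_ (lexx _)).
rewrite (dualZ _ (dphi n)) normrM normfV normr_id ler_pdivrMl// mulrC => /le_trans; apply.
by rewrite ler_wpM2r// le_max lexx.
Qed.

Lemma epigraph_normal_of_limiting_normal (R : realType)
    (X : completeNormedModType R) (f : X -> \bar R) (xbar : X) (phi : X -> R^o) :
  lower_semicontinuous f -> f xbar = 0%E -> local_error_bound f xbar ->
  limiting_normal (solution_set f) xbar phi ->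
  exists2 l : R, 0 <= l &
    limiting_normal (epigraph f) (xbar, 0) (pair_dual phi (- l)).
Proof.
move=> lscf fx0 [tau [delta [tau0 delta0 bound]]].
move=> [dphi [eps [x [psi [[eps0 deps] eps_cvg [Sx x_cvg] npsi psi_cvg]]]]].
have [M M0 psiM] := ptws_cvg_bounded (fun n => (npsi n).1) psi_cvg.
(* Past index [N] the base points lie in the open ball of the error bound, which therefore holds
   near each of them. *)
have /x_cvg[N _ xN] : nbhs xbar (ball xbar delta) by exact: nbhsx_ballx.
have /choice[zl zlP] n : exists zl : (X * R^o) * R, [/\ epigraph f zl.1,
    `|zl.1 - (x (n + N)%N, 0)| <= n.+1%:R^-1, 0 <= zl.2 <= M * tau &
    eps_normal (3 * eps (n + N)%N + n.+1%:R^-1) (epigraph f) zl.1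
      (pair_dual (psi (n + N)%N) (- zl.2))].
  have [||||||z [l ?]] := @epigraph_normal_of_solution_normal R X f tau M
      (eps (n + N)%N) (x (n + N)%N) (psi (n + N)%N) n.+1%:R^-1 lscf tau0 M0.
  - exact: eps0.
  - have := xN (n + N)%N (leq_addl _ _); rewrite /= => xb.
    have : nbhs (x (n + N)%N) (ball xbar delta).
      by apply: open_nbhs_nbhs; split => //; exact: ball_open.
    by apply: filterS => y /bound.
  - exact: psiM.
  - exact: Sx.
  - exact: npsi.
  - by rewrite invr_gt0.
  - by exists (z, l).
(* The slopes all lie in [[0, M * tau]], where [M] bounds every [psi n]; this is what the uniform
   bound is for. *)
have [|g g_incr /cvg_ex[l l_cvg]] := @bolzano_weierstrass R (snd \o zl).
  exists (M * tau); split; first exact: num_real.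
  move=> t Mt n _ /=; have [_ _ /andP[l0 l1] _] := zlP n.
  by rewrite ger0_norm// (le_trans l1)// ltW.
have g_ge n : (n <= g n)%N.
  elim: n => // n ih; apply: leq_ltn_trans ih _.
  exact: (increasing_seqP g).2 g_incr n.
have g_cvg : g n @[n --> \oo] --> \oo.
  move=> P [k _ kP]; exists k => // n /= kn; apply: kP => /=.
  exact: leq_trans kn (g_ge n).
have gN_cvg : (g n + N)%N @[n --> \oo] --> \oo.
  move=> P [k _ kP]; exists k => // n /= kn; apply: kP => /=.
  exact: leq_trans kn (leq_trans (g_ge n) (leq_addr _ _)).
have inv_cvg : (g n).+1%:R^-1 @[n --> \oo] --> (0 : R).
  exact: (cvg_comp _ _ g_cvg (@cvg_harmonic R)).
exists l.
  apply: (closed_cvg _ (@closed_ge R 0) _ l l_cvg).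
  by apply: nearW => n; have [_ _ /andP[]] := zlP (g n).
split; first exact: pair_dual_topological.
exists (fun n => 3 * eps (g n + N)%N + (g n).+1%:R^-1), (fun n => (zl (g n)).1),
  (fun n => pair_dual (psi (g n + N)%N) (- (zl (g n)).2)); split.
- split=> [n|m n mn].
    by rewrite addr_ge0 ?invr_ge0// mulr_ge0.
  have gmn : (g m <= g n)%N by rewrite -leEnat g_incr.
  rewrite lerD ?ler_wpM2l//; first by rewrite deps// leq_add2r.
  by rewrite lef_pV2 ?posrE// ler_nat ltnS.
- rewrite -[X in _ --> X]addr0; apply: (@cvgD _ R) => //.
  rewrite -[X in _ --> X](mulr0 3); apply: (@cvgM R); first exact: cvg_cst.
  exact: (cvg_comp _ _ gN_cvg eps_cvg).
- split=> [n|]; first by have [] := zlP (g n).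
  have x0_cvg : (x (g n + N)%N, 0 : R^o) @[n --> \oo] --> (xbar, 0 : R^o).
    apply: (@cvg_pair _ _ _ _ (nbhs xbar) (nbhs (0 : R^o))).
      exact: (cvg_comp _ _ gN_cvg x_cvg).
    exact: cvg_cst.
  (* Compare with [(x (g n + N), 0)]: it tends to [(xbar, 0)], and the Ekeland displacement is at
     most [(g n).+1%:R^-1]. *)
  apply/cvgrPdist_lt => e e0; near=> n.
  rewrite (le_lt_trans (ler_distD (x (g n + N)%N, 0) _ _))// (splitr e) ltrD//.
    near: n; move/cvgrPdist_lt : x0_cvg; apply; exact: divr_gt0.
  have [_ zx _ _] := zlP (g n).
  rewrite distrC (le_lt_trans zx)//.
  near: n; have /cvgrPdist_lt/(_ (e / 2))[|k _ kP] := inv_cvg; first exact: divr_gt0.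
  by exists k => // n /= /kP; rewrite /= sub0r normrN ger0_norm ?invr_ge0.
- by move=> n; have [] := zlP (g n).
- apply/pointwise_cvgP => -[v r].
  apply: (@cvgD _ R).
    have psi_v : psi n v @[n --> \oo] --> phi v.
      by move/pointwise_cvgP : psi_cvg; apply.
    exact: (cvg_comp _ _ gN_cvg psi_v).
  by apply: (@cvgM R); [exact: (@cvgN _ R)|exact: cvg_cst].
Unshelve. all: by end_near. Qed.

(** * Decomposition of a normal according to the sign of [f xbar] and the limiting slope *)

Theorem theorem3p1 (R : realType) (X : completeNormedModType R)
    (f : X -> \bar R) (xbar : X) :
  asplund X ->
  proper_function f ->
  lower_semicontinuous f ->
  solution_set f xbar ->
  local_error_bound f xbar ->
  {for xbar, continuous f} ->
  limiting_normal (solution_set f) xbar `<=`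
    set_sum (nonneg_multiples (subdifferential f xbar))
            (singular_subdifferential f xbar).
Proof.
move=> _ [f_proper _] lscf Sxbar bound cf phi nphi.
have dphi : topological_dual phi by case: nphi.
have fin : f xbar \is a fin_num.
  by rewrite fin_numE f_proper lt_eqF// (le_lt_trans Sxbar)// ltry.
(* This is the second summand whenever [phi] comes entirely from the multiples of the
   subdifferential. *)
have sing0 : singular_subdifferential f xbar 0.
  split; first by case: (@limiting_normal0 _ X setT xbar I).
  rewrite (_ : pair_dual 0 0 = 0).
    by apply: limiting_normal0; rewrite /epigraph /= fineK.
  by apply/funext => z; rewrite /pair_dual mul0r addr0.
have [fxbar_lt0|] := ltP (f xbar) 0%E.
  have Sn : nbhs xbar (solution_set f).
    have : \forall x \near xbar, (f x < 0)%E.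
      exact: (cf _ (open_nbhs_nbhs (conj (@open_ereal_lt_ereal R 0%E) fxbar_lt0))).
    by apply: filterS => x /ltW.
  rewrite (limiting_normal_interior Sn nphi).
  by exists 0; [left|exists 0; rewrite ?addr0].
move=> fxbar_ge0; have fxbar0 : f xbar = 0%E.
  by apply/eqP; rewrite eq_le fxbar_ge0 andbT; exact: Sxbar.
have [l l0 nl] := epigraph_normal_of_limiting_normal lscf fxbar0 bound nphi.
have [l00|lneq0] := eqVneq l 0.
  (* The subdifferential may be empty here, so 0 is taken from the convention in
     [nonneg_multiples]. *)
  exists 0; first by left.
  exists phi; last by rewrite add0r.
  by split=> //; rewrite fxbar0; move: nl; rewrite l00 oppr0.
have {lneq0}l0 : 0 < l by rewrite lt_neqAle eq_sym lneq0.
exists phi; last by exists 0; rewrite ?addr0.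
right; exists l; first by rewrite /= in_itv /= ltW.
(* Scaling the normal [(phi, - l)] by [l^-1] brings its last coordinate to [-1]. *)
exists (l^-1 *: phi); last by rewrite scalerA mulfV ?gt_eqF// scale1r.
split; first exact: dual_scale.
rewrite fxbar0 (_ : pair_dual _ _ = l^-1 *: pair_dual phi (- l)).
  by apply: limiting_normalZ => //; rewrite invr_gt0.
apply/funext => z; rewrite /pair_dual !fctE scalerDr; congr (_ + _).
by rewrite /GRing.scale /= mulrA mulrN mulVf ?gt_eqF.
Qed.
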